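(* Let $\mathscr{L}$ be a variadic language, let $\mathscr{M}$ be a structure for $\mathscr{L}$, and let $s$ be an assignment. If $r$ and $t$ are terms of $\mathscr{L}$ and $x$ is a variable such that $t$ is substitutable for $x$ in $r$, then $r(x|t)^s=r^{s(x|t^s)}$.
   Context: $\mathbb{N}=\{0,1,2,\dots\}$ and $\mathbb{N}^{<\mathbb{N}}$ is the set of finite sequences of naturals. Variadic language: a first-order language, including a constant symbol $\mathbf{n}$ for every $n\in\mathbb{N}$, together with a set of variadic function symbols, and a special symbol $\cdots_x$ for every variable $x$. Every language is assumed to satisfy: (1) every symbol is exactly one of: a left parenthesis, a right parenthesis, a logical connective, $=$, a constant symbol, a variable, an $n$-ary predicate symbol for some $n$, an $n$-ary function symbol for some $n$, a variadic function symbol, or an ellipsis $\cdots_x$ for some variable $x$; (2) if a symbol is an $n$-ary function (resp. predicate) symbol and an $m$-ary function (resp. predicate) symbol then $n=m$; (3) if a symbol is both $\cdots_x$ and $\cdots_y$ then $x$ and $y$ are the same variable. (So terms are uniquely readable.) Structure for $\mathscr{L}$: a structure $\mathscr{M}$ for the first-order part of $\mathscr{L}$, with universe $\mathbb{N}$, interpreting each $\mathbf{n}$ as $n$, together with a function $G^{\mathscr{M}}:\mathbb{N}^{<\mathbb{N}}\to\mathbb{N}$ for every variadic function symbol $G$. For $n\in\mathbb{N}$, $\overline{n}$ also denotes the constant symbol $\mathbf{n}$. Terms and their free variables: a constant symbol $c$ is a term, $FV(c)=\emptyset$; a variable $x$ is a term, $FV(x)=\{x\}$; if $f$ is an $n$-ary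 or variadic function symbol and $u_1,\dots,u_n$ are terms then $f(u_1,\dots,u_n)$ is a term with free variables $FV(u_1)\cup\cdots\cup FV(u_n)$; if $G$ is a variadic function symbol, $u,v$ are terms and $x$ is a variable then $G(u(\mathbf{0})\cdots_x u(v))$ is a term (a purely formal expression built from $G,u,x,v$) with free variables $(FV(u)\setminus\{x\})\cup FV(v)$. Term substitution $r(x|t)$ (substituting $t$ for $x$ in $r$): $c(x|t)=c$ for constants; $x(x|t)=t$; $y(x|t)=y$ for variables $y\neq x$; $f(u_1,\dots,u_n)(x|t)=f(u_1(x|t),\dots,u_n(x|t))$; if $r$ is $G(u(\mathbf{0})\cdots_x u(v))$ then $r(x|t)$ is $G(u(\mathbf{0})\cdots_x u(v(x|t)))$; if $r$ is $G(u(\mathbf{0})\cdots_y u(v))$ with $y\neq x$ then $r(x|t)$ is $G(u(x|t)(\mathbf{0})\cdots_y u(x|t)(v(x|t)))$, i.e. the formal expression built from $G$, $u(x|t)$, $y$, $v(x|t)$. Assignment: a function $s$ from variables to the universe $\mathbb{N}$; $s(x|n)$ is the assignment agreeing with $s$ except that it maps $x$ to $n$. (Syntactic) interpretation $t^s\in\mathbb{N}$ of a term, by recursion on complexity: $c^s=c^{\mathscr{M}}$; $x^s=s(x)$; $f(u_1,\dots,u_k)^s=f^{\mathscr{M}}(u_1^s,\dots,u_k^s)$; and $G(u(\mathbf{0})\cdots_x u(v))^s=G^{\mathscr{M}}(u(x|\mathbf{0})^s,u(x|\mathbf{1})^s,\dots,u(x|\overline{v^s})^s)$, a sequence of $v^s+1$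 arguments. Substitutability of $t$ for $x$ in a term $r$, inductively: if $r$ is a variable or constant symbol, $t$ is substitutable for $x$ in $r$; if $r$ is $f(u_1,\dots,u_n)$ with $f$ $n$-ary or variadic, $t$ is substitutable for $x$ in $r$ iff it is in all the $u_i$; if $r$ is $G(u(\mathbf{0})\cdots_y u(v))$ ($y$ may or may not be $x$), $t$ is substitutable for $x$ in $r$ iff at least one of: $x$ is not a free variable of $r$; or $y=x$ and $t$ is substitutable for $x$ in $v$; or $y$ is not a free variable of $t$ and $t$ is substitutable for $x$ in both $u$ and $v$. *)

(* Defs.v *)
From mathcomp Require Import all_boot finmap.

Set Implicit Arguments.
Unset Strict Implicit.
Unset Printing Implicit Defensive.

Local Open Scope fset_scope.

(* The sorts of symbols are distinct types, so the disjointness conditions that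
   make terms uniquely readable hold by construction; there is one ellipsis for
   each variable, which is the variable argument of [Ell] below. *)
Record language : Type := Language {
  var : choiceType;
  cst : Type;
  num : nat -> cst;
  func : Type;
  arity : func -> nat;
  predicate : Type;
  pred_arity : predicate -> nat;
  vfunc : Type
}.

Record structure (L : language) : Type := Structure {
  cst_val : cst L -> nat;
  cst_val_num : forall n, cst_val (num L n) = n;
  func_val : forall f : func L, (arity f).-tuple nat -> nat;
  pred_val : forall P : predicate L, (pred_arity P).-tuple nat -> Prop;
  vfunc_val : vfunc L -> seq nat -> nat
}.

Arguments cst_val {L} M c : rename.
Arguments func_val {L} M f a : rename.
Arguments vfunc_val {L} M G a : rename.

(* [Ell G u x v] is the formal expression G(u(0) ..._x u(v)). *)
Inductive term (L : language) : Type :=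
| Var of var L
| Cst of cst L
| App (f : func L) of {ffun 'I_(arity f) -> term L}
| VApp (G : vfunc L) (n : nat) of {ffun 'I_n -> term L}
| Ell (G : vfunc L) (u : term L) (x : var L) (v : term L).

Arguments Var {L}.
Arguments Cst {L}.
Arguments App {L}.
Arguments VApp {L}.
Arguments Ell {L}.

Definition numeral (L : language) (n : nat) : term L := Cst (num L n).
Arguments numeral {L} n.

Fixpoint FV (L : language) (r : term L) : {fset var L} :=
  match r with
  | Var x => [fset x]
  | Cst _ => fset0
  | App f us => \big[fsetU/fset0]_(i < arity f) FV (us i)
  | VApp _ n us => \big[fsetU/fset0]_(i < n) FV (us i)
  | Ell _ u x v => (FV u `\ x) `|` FV v
  end.

(* [subst x t r] is r(x|t); in the ellipsis case with bound variable [x], only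
   the upper bound [v] is affected. *)
Fixpoint subst (L : language) (x : var L) (t r : term L) : term L :=
  match r with
  | Var y => if y == x then t else Var y
  | Cst c => Cst c
  | App f us => App f [ffun i => subst x t (us i)]
  | VApp G n us => VApp G n [ffun i => subst x t (us i)]
  | Ell G u y v => Ell G (if y == x then u else subst x t u) y (subst x t v)
  end.

Fixpoint substitutable (L : language) (t : term L) (x : var L) (r : term L) :
    Prop :=
  match r with
  | Var _ | Cst _ => True
  | App f us => forall i, substitutable t x (us i)
  | VApp _ n us => forall i, substitutable t x (us i)
  | Ell G u y v =>
      [\/ x \notin FV (Ell G u y v),
          y = x /\ substitutable t x v
        | [/\ y \notin FV t, substitutable t x u & substitutable t x v]]
  end.

Definition assignment (L : language) : Type := var L -> nat.

Definition update (L : language) (s : assignment L) (x : var L) (n : nat) :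
    assignment L := [eta s with x |-> n].

Fixpoint complexity (L : language) (r : term L) : nat :=
  match r with
  | Var _ | Cst _ => 0
  | App f us => (\max_(i < arity f) complexity (us i)).+1
  | VApp _ n us => (\max_(i < n) complexity (us i)).+1
  | Ell _ u _ v => (maxn (complexity u) (complexity v)).+1
  end.

(* The clause for an ellipsis evaluates the terms u(x|numeral i), which are not
   subterms, so the recursion is on a bound [k] on the complexity; the value at
   [k = 0] is never used, and [interp_Var] ... [interp_Ell] below are the
   defining equations. *)
Fixpoint interp_rec (L : language) (M : structure L) (s : assignment L)
    (k : nat) (r : term L) : nat :=
  if k is k'.+1 then
    match r with
    | Var x => s x
    | Cst c => cst_val M c
    | App f us =>
        func_val M f [tuple interp_rec M s k' (us i) | i < arity f]
    | VApp G n us =>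
        vfunc_val M G [tuple interp_rec M s k' (us i) | i < n]
    | Ell G u x v =>
        vfunc_val M G [seq interp_rec M s k' (subst x (numeral i) u)
                      | i <- iota 0 (interp_rec M s k' v).+1]
    end
  else 0.

Definition interp (L : language) (M : structure L) (s : assignment L)
    (r : term L) : nat := interp_rec M s (complexity r).+1 r.

Lemma term_nested_ind (L : language) (P : term L -> Prop) :
  (forall x, P (Var x)) ->
  (forall c, P (Cst c)) ->
  (forall (f : func L) (us : {ffun 'I_(arity f) -> term L}),
      (forall i, P (us i)) -> P (App f us)) ->
  (forall G n (us : {ffun 'I_n -> term L}), (forall i, P (us i)) -> P (VApp G n us)) ->
  (forall G u x v, P u -> P v -> P (Ell G u x v)) ->
  forall r, P r.
Proof.
move=> Pvar Pcst Papp Pvapp Pell; fix IH 1.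
case=> [x|c|f us|G n us|G u x v].
- exact: Pvar.
- exact: Pcst.
- by apply: Papp => i; apply: IH.
- by apply: Pvapp => i; apply: IH.
- by apply: Pell; apply: IH.
Qed.

Lemma complexity_subst_numeral (L : language) (x : var L) (n : nat)
  (r : term L) : complexity (subst x (numeral n) r) = complexity r.
Proof.
elim/term_nested_ind: r => [y|c|f us IH|G m us IH|G u y v IHu IHv] //=.
- by case: (y == x).
- by congr _.+1; apply: eq_bigr => i _; rewrite ffunE.
- by congr _.+1; apply: eq_bigr => i _; rewrite ffunE.
- by rewrite IHv; case: (y == x); rewrite ?IHu.
Qed.

Lemma interp_recE (L : language) (M : structure L) (s : assignment L)
  (k : nat) (r : term L) :
  complexity r < k -> interp_rec M s k r = interp M s r.
Proof.
rewrite /interp; suff E m : forall k' r', complexity r' < m ->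
    complexity r' < k' -> interp_rec M s m r' = interp_rec M s k' r'.
  by move=> rk; apply: E.
elim: m => [//|m IH] [//|k'] [x|c|f us|G n us|G u x v] //=; rewrite !ltnS.
- move=> um uk; congr func_val; apply: eq_from_tnth => i; rewrite !tnth_mktuple.
  by apply: IH; [apply: leq_ltn_trans um|apply: leq_ltn_trans uk];
    apply: (leq_bigmax (F := fun j => complexity (us j))).
- move=> um uk; congr vfunc_val; apply: eq_map => i.
  by apply: IH; [apply: leq_ltn_trans um|apply: leq_ltn_trans uk];
    apply: (leq_bigmax (F := fun j => complexity (us j))).
- rewrite !gtn_max => /andP[um vm] /andP[uk vk]; rewrite (IH k' v) //.
  have E i : interp_rec M s m (subst x (numeral i) u) =
             interp_rec M s k' (subst x (numeral i) u).
    by apply: IH; rewrite complexity_subst_numeral.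
  by rewrite E (eq_map E).
Qed.

Section InterpEquations.
Variables (L : language) (M : structure L) (s : assignment L).

Lemma interp_Var x : interp M s (Var x) = s x.
Proof. by []. Qed.

Lemma interp_Cst c : interp M s (Cst c) = cst_val M c.
Proof. by []. Qed.

Lemma interp_App (f : func L) (us : {ffun 'I_(arity f) -> term L}) :
  interp M s (App f us) =
  func_val M f [tuple interp M s (us i) | i < arity f].
Proof.
rewrite [LHS](erefl : _ = func_val M f
  [tuple interp_rec M s (complexity (App f us)) (us i) | i < arity f]).
congr func_val; apply: eq_from_tnth => i; rewrite !tnth_mktuple interp_recE //=.
by rewrite ltnS (leq_bigmax (F := fun j => complexity (us j))).
Qed.

Lemma interp_VApp G n (us : {ffun 'I_n -> term L}) :
  interp M s (VApp G n us) = vfunc_val M G [tuple interp M s (us i) | i < n].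
Proof.
rewrite [LHS](erefl : _ = vfunc_val M G
  [tuple interp_rec M s (complexity (VApp G n us)) (us i) | i < n]).
congr vfunc_val; apply: eq_map => i; rewrite interp_recE //=.
by rewrite ltnS (leq_bigmax (F := fun j => complexity (us j))).
Qed.

Lemma interp_Ell G u x v :
  interp M s (Ell G u x v) =
  vfunc_val M G [seq interp M s (subst x (numeral i) u)
                | i <- iota 0 (interp M s v).+1].
Proof.
rewrite [LHS](erefl : _ = vfunc_val M G
  [seq interp_rec M s (complexity (Ell G u x v)) (subst x (numeral i) u)
  | i <- iota 0 (interp_rec M s (complexity (Ell G u x v)) v).+1]).
rewrite [X in X.+1]interp_recE ?ltnS ?leq_maxr //.
congr vfunc_val; apply: eq_map => i.
by rewrite interp_recE // complexity_subst_numeral ltnS leq_maxl.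
Qed.

End InterpEquations.

(* Main.v *)
Require Import Defs.
From mathcomp Require Import all_boot finmap.

(** The only obstacle to a structural induction is the ellipsis clause of the
    interpretation, which evaluates the terms u(x|i) rather than the subterm u.
    Numerals are closed and denote the same number under every assignment, so
    replacing a variable by a numeral amounts to updating the assignment
    ([interp_subst_numeral]).  Hence the ellipsis acts as an ordinary binder:
    its value is computed from those of u under the assignments s(x|i)
    ([interp_Ell_update]).

    With this compositional clause the rest is as for a quantifier in
    first-order logic.  A term depends only on the values of its free variables
    ([eq_interp_FV]); so when x is not free in r, both the substitution
    ([subst_notin_FV]) and the update ([interp_update_notin_FV]) have no effect.
    Otherwise, in the induction over r, the variable y bound by an ellipsis
    either is x, so that s(x|i) overrides any earlier value at x, or differs
    from x and is not free in t, so that t has the same value under s and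
    s(y|i), and the two updates commute. *)

Section Interpretation.
Set Implicit Arguments.
Unset Strict Implicit.
Variables (L : language) (M : structure L).
Implicit Types (s : assignment L) (r t u v : term L) (x y : var L).

Lemma updateE s x n y : update s x n y = if y == x then n else s y.
Proof. by []. Qed.

Lemma leq_complexity_arg n (us : {ffun 'I_n -> term L}) i :
  complexity (us i) <= \max_(j < n) complexity (us j).
Proof. exact: (leq_bigmax (F := fun j => complexity (us j))). Qed.

(** The induction is on complexity, because in the ellipsis case the claim is
    needed for u(y|n), which is no subterm but is as complex as u.  That s' only
    has to agree pointwise with the update lets each use of the induction
    hypothesis reorder updates. *)
Lemma interp_subst_numeral r s s' y n :
  s' =1 update s y n -> interp M s (subst y (numeral n) r) = interp M s' r.
Proof.
have [k] := ubnP (complexity r).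
elim: k r s s' y n => // k IH r s s' y n; rewrite ltnS.
case: r => [z|c|f us|G m us|G u z v] /= rk ss'.
- rewrite [RHS]interp_Var ss' updateE; case: eqP => // _.
  by rewrite interp_Cst cst_val_num.
- by [].
- rewrite !interp_App; congr func_val; apply: eq_from_tnth => i.
  rewrite !tnth_mktuple ffunE; apply: IH ss'.
  exact: leq_ltn_trans (leq_complexity_arg us i) rk.
- rewrite !interp_VApp; congr vfunc_val; apply: eq_map => i.
  rewrite ffunE; apply: IH ss'.
  exact: leq_ltn_trans (leq_complexity_arg us i) rk.
move: rk; rewrite gtn_max => /andP[uk vk].
rewrite !interp_Ell (IH _ _ _ _ _ vk ss'); congr vfunc_val; apply: eq_map => i.
rewrite (IH u s' (update s' z i)) //.
case: (eqVneq z y) => [zy|zy].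
  by apply: IH => // w; rewrite !updateE ss' updateE -zy; case: (w == z).
(* The substitution for y sits inside the one for z, so z is moved into the
   assignment first. *)
rewrite (IH (subst y (numeral n) u) s (update s z i)) //; last first.
  by rewrite complexity_subst_numeral.
apply: IH => // w; rewrite !updateE ss' updateE.
by case: (w =P z) => // ->; rewrite (negPf zy).
Qed.

Lemma interp_Ell_update s G u x v :
  interp M s (Ell G u x v) =
  vfunc_val M G [seq interp M (update s x i) u
                | i <- iota 0 (interp M s v).+1].
Proof.
rewrite interp_Ell; congr vfunc_val; apply: eq_map => i.
exact: interp_subst_numeral.
Qed.

Lemma FV_arg n (us : {ffun 'I_n -> term L}) i x :
  x \in FV (us i) -> x \in (\big[fsetU/fset0]_(j < n) FV (us j))%fset.
Proof. by move=> xi; apply/bigfcupP; exists i; rewrite ?mem_index_enum. Qed.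

Lemma eq_interp_FV r s s' :
  {in FV r, s =1 s'} -> interp M s r = interp M s' r.
Proof.
elim/term_nested_ind: r s s' =>
  [x|c|f us IH|G n us IH|G u x v IHu IHv] s s' ss'.
- by apply: ss'; rewrite /= inE.
- by [].
- rewrite !interp_App; congr func_val; apply: eq_from_tnth => i.
  by rewrite !tnth_mktuple; apply: IH => x /FV_arg; apply: ss'.
- rewrite !interp_VApp; congr vfunc_val; apply: eq_map => i.
  by apply: IH => x /FV_arg; apply: ss'.
rewrite !interp_Ell_update (IHv s s'); last first.
  by move=> y yv; apply: ss'; rewrite /= inE yv orbT.
congr vfunc_val; apply: eq_map => i.
apply: IHu => y yu; rewrite !updateE; case: (eqVneq y x) => // yx.
by apply: ss'; rewrite /= !inE yx yu.
Qed.

Lemma interp_update_notin_FV r s x n :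
  x \notin FV r -> interp M (update s x n) r = interp M s r.
Proof.
move=> xr; apply: eq_interp_FV => y yr.
by rewrite updateE; case: (eqVneq y x) yr xr => // -> ->.
Qed.

Lemma subst_notin_FV r t x : x \notin FV r -> subst x t r = r.
Proof.
elim/term_nested_ind: r => [y|c|f us IH|G n us IH|G u y v IHu IHv] //= xr.
- by move: xr; rewrite inE eq_sym => /negPf->.
- congr App; apply/ffunP=> i; rewrite ffunE IH //.
  by apply: contra xr; apply: FV_arg.
- congr VApp; apply/ffunP=> i; rewrite ffunE IH //.
  by apply: contra xr; apply: FV_arg.
move: xr; rewrite !inE negb_or negb_and negbK eq_sym => /andP[xu xv].
by rewrite IHv //; case: eqP xu => //= _ xu; rewrite IHu.
Qed.

End Interpretation.

Theorem theorem9 (L : language) (M : structure L) (s : assignment L)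
    (r t : term L) (x : var L) (hsub : substitutable t x r) :
  interp M s (subst x t r) = interp M (update s x (interp M s t)) r.
Proof.
elim/term_nested_ind: r s hsub => [y|c|f us IH|G n us IH|G u y v IHu IHv] s.
- by move=> _; rewrite [RHS]interp_Var updateE /=; case: eqP.
- by [].
- move=> /= hus; rewrite !interp_App; congr func_val; apply: eq_from_tnth => i.
  by rewrite !tnth_mktuple ffunE; apply: IH.
- move=> /= hus; rewrite !interp_VApp; congr vfunc_val; apply: eq_map => i.
  by rewrite ffunE; apply: IH.
case=> [xr|[-> hv]|[yt hu hv]].
- by rewrite subst_notin_FV // interp_update_notin_FV.
- rewrite /= eqxx !interp_Ell_update IHv //.
  congr vfunc_val; apply: eq_map => i.
  by apply: eq_interp_FV => z _; rewrite !updateE; case: eqP.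
rewrite /= !interp_Ell_update IHv //; congr vfunc_val; apply: eq_map => i.
(* The third clause of substitutability allows y = x as well; u is then left
   unchanged by the substitution, as under the second clause. *)
case: eqP => [->|/eqP yx].
  by apply: eq_interp_FV => z _; rewrite !updateE; case: eqP.
rewrite IHu // (interp_update_notin_FV _ _ _ yt); apply: eq_interp_FV => z _.
by rewrite !updateE; case: (eqVneq z x) => // ->; rewrite eq_sym (negPf yx).
Qed.
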